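(* Let $d\ge 1$ and $\rho<\frac{R}{2}$. With access to a bit oracle with permissible queries $\mathcal{Q}^{bit}$, we have $$\operatorname{icomp}(\mathcal{I}_{n,d,R,\rho},\mathcal{Q}^{bit})=\Omega\left(2^n d^2\log\left(\frac{R}{\rho}\right)\right).$$ In fact, this holds even if the query returns the entire coordinate as opposed to just a single bit of a desired coordinate of the normal vector of the separating hyperplane: under the same conditions, $$\operatorname{icomp}(\mathcal{I}_{n,d,R,\rho},\mathcal{Q}^{coord})=\Omega\left(2^n d^2\log\left(\frac{R}{\rho}\right)\right).$$
   Context: Throughout, $n\ge 0$ and $d\ge 1$ are integers (numbers of integer and continuous variables), $R,\rho>0$ are reals, and $\Omega$ hides a universal positive constant. **Instances.** $\mathcal{I}_{n,d,R,\rho}$ is the family of all closed convex sets $C\subseteq\mathbb{R}^n\times\mathbb{R}^d$ such that $C\subseteq[-R,R]^{n+d}$ and, if $C$ is feasible (i.e. $C\cap(\mathbb{Z}^n\times\mathbb{R}^d)\neq\emptyset$), then there exists $(x^\star,y^\star)\in\mathbb{Z}^n\times\mathbb{R}^d$ with $\{(x^\star,y): y\in\mathbb{R}^d,\ \|y-y^\star\|_\infty\le\rho\}\subseteq C$. Infeasible sets (including $C=\emptyset$) are allowed. **Feasibility problem.** For an unknown instance $C\in\mathcal{I}_{n,d,R,\rho}$, report a point of $C\cap(\mathbb{Z}^n\times\mathbb{R}^d)$ if one exists, and otherwise report that the instance is infeasible. **First-order map.** A first-order map for $\mathcal{I}_{n,d,R,\rho}$ is a function $\mathcal{G}:\mathcal{I}_{n,d,R,\rho}\times(\mathbb{R}^n\times\mathbb{R}^d)\to\mathbb{R}^n\times\mathbb{R}^d$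 such that $\mathcal{G}(C,\hat z)=0$ if $\hat z\in C$; otherwise $\mathcal{G}(C,\hat z)$ is the (nonzero) normal vector of a separating hyperplane, satisfying $\langle\mathcal{G}(C,\hat z),z\rangle<\langle\mathcal{G}(C,\hat z),\hat z\rangle$ for all $z\in C$. **Oracle.** Given a set $\mathcal{Q}$ of permissible queries (functions on $\mathbb{R}^n\times\mathbb{R}^d$) and a first-order map $\mathcal{G}$, the oracle $\mathcal{O}(\mathcal{Q},\mathcal{G})$ takes a point $z\in\mathbb{R}^n\times\mathbb{R}^d$ and a query $q\in\mathcal{Q}$, and returns for the instance $C$ the answer $q(\mathcal{G}(C,z))$. Without knowing the instance $C$, and based only on the oracle responses so far, the algorithm chooses in each step a pair $(z,q)$ and receives the answer. **Information complexity.** $\operatorname{icomp}(\mathcal{I}_{n,d,R,\rho},\mathcal{Q})$ is the minimum natural number $k$ such that there exists an algorithm that solves the feasibility problem for $\mathcal{I}_{n,d,R,\rho}$ by making at most $k$ queries to the oracle $\mathcal{O}(\mathcal{Q},\mathcal{G})$, for any first-order map $\mathcal{G}$. **Query sets.** $\mathcal{Q}^{bit}$ (bit oracle) is the set of queries $q_{ij}$, where $q_{ij}(g)$ is the $i$-th bit of the $j$-th coordinate of $g\in\mathbb{R}^n\times\mathbb{R}^d$. $\mathcal{Q}^{coord}$ (coordinate oracle) is the set of queries $q_j$, $j\in\{1,\dots,n+d\}$, with $q_j(g)=g_j$.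
   Formalization: The coordinate-oracle bound is stated under the added condition that n = 0 or R ≥ 1; for R < 1 and n ≥ 1 only the fibre x = 0 matters, and e.g. d = 1, R = 1/2, ρ = 1/8 is solved with n + O(1) queries, so Ω(2^n) fails. *)

(* Defs.v *)
From HB Require Import structures.
From mathcomp Require Import all_boot all_order all_algebra.
From mathcomp Require Import all_classical all_reals all_analysis.
Set Implicit Arguments.
Unset Strict Implicit.
Unset Printing Implicit Defensive.
Import Order.TTheory GRing.Theory Num.Theory.
Import numFieldNormedType.Exports.
Local Open Scope classical_set_scope.
Local Open Scope ring_scope.

Definition mipoint (R : realType) (n d : nat) : Type := ('rV[R]_n * 'rV[R]_d)%type.

Section MixedIntegerFeasibility.
Context {R : realType} {n d : nat}.
Local Notation mipoint := (mipoint R n d).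

(* Coordinates j < n are the integer variables, the remaining d the continuous ones *)
Definition coord (z : mipoint) (j : 'I_(n + d)) : R := row_mx z.1 z.2 ord0 j.

Definition dot (g z : mipoint) : R := \sum_(j < n + d) coord g j * coord z j.

Definition mixed_integer : set mipoint :=
  [set z | z.1 \is a mxOver Num.int].

(* `|y - ystar| is the sup norm: it is the library's norm on matrices *)
Definition instances (Rad rho : R) : set (set mipoint) :=
  [set C | [/\ closed (C : set ('rV[R]_n * 'rV[R]_d)),
               convex_set (C : set ('rV[R]_n * 'rV[R]_d)),
               (forall z, C z -> forall j, `|coord z j| <= Rad) &
               C `&` mixed_integer !=set0 ->
                 exists xstar (ystar : 'rV[R]_d), mixed_integer (xstar, ystar) /\
                   [set (xstar, y) | y in [set y | `|y - ystar| <= rho]] `<=` C]].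

Definition first_order_map (Rad rho : R) (G : set mipoint -> mipoint -> mipoint) :=
  forall C, instances Rad rho C -> forall zhat,
    (C zhat -> G C zhat = (0, 0)) /\
    (~ C zhat -> G C zhat <> (0, 0) /\
       forall z, C z -> dot (G C zhat) z < dot (G C zhat) zhat).

(* Deterministic adaptive algorithms, as decision trees: [Report None] declares
   infeasibility, [Ask z q next] continues with [next a] on the answer [a].
   The set [Q] of permissible queries is coerced to a subtype. *)
Inductive algorithm (A : Type) (Q : set (mipoint -> A)) : Type :=
| Report of option mipoint
| Ask of mipoint & Q & (A -> algorithm Q).

Definition oracle (A : Type) (Q : set (mipoint -> A)) (G : set mipoint -> mipoint -> mipoint)
    (C : set mipoint) (z : mipoint) (q : Q) : A := val q (G C z).

Fixpoint run (A : Type) (Q : set (mipoint -> A)) (answer : mipoint -> Q -> A)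
    (alg : algorithm Q) : option mipoint * nat :=
  match alg with
  | Report o => (o, 0%N)
  | Ask z q next =>
      let: (o, m) := run answer (next (answer z q)) in (o, m.+1)
  end.

Definition correct_report (C : set mipoint) (o : option mipoint) : Prop :=
  match o with
  | Some z => (C `&` mixed_integer) z
  | None => C `&` mixed_integer = set0
  end.

Definition solves_within (Rad rho : R) (A : Type) (Q : set (mipoint -> A))
    (k : nat) (alg : algorithm Q) : Prop :=
  forall G, first_order_map Rad rho G -> forall C, instances Rad rho C ->
    correct_report C (run (oracle G C) alg).1 /\
    ((run (oracle G C) alg).2 <= k)%N.

(* Bits of a real in sign-magnitude binary representation: [None] is the sign
   bit, [Some i] the digit of weight 2 ^ i (i may be negative). *)
Definition bit (i : option int) (r : R) : bool :=
  match i with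
  | None => r < 0
  | Some i => odd `|Num.floor (`|r| / 2 ^ i)|%N
  end.

Definition Qbit : set (mipoint -> bool) :=
  [set q | exists i j, q = fun g => bit i (coord g j)].

Definition Qcoord : set (mipoint -> R) :=
  [set q | exists j, q = fun g => coord g j].

End MixedIntegerFeasibility.

(* The minimum over an empty set of k is +oo *)
Definition icomp (R : realType) (n d : nat) (Rad rho : R) (A : Type)
    (Q : set (mipoint R n d -> A)) : \bar R :=
  ereal_inf [set (k%:R)%:E | k in [set k : nat |
    exists alg : algorithm Q, solves_within Rad rho k alg]].

(* Main.v *)
Require Import Defs.
From HB Require Import structures.
From mathcomp Require Import all_boot all_order all_algebra.
From mathcomp Require Import all_classical all_reals all_analysis.
From mathcomp Require Import lra zify.
Import Order.TTheory GRing.Theory Num.Theory.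
Import numFieldNormedType.Exports.
Local Open Scope classical_set_scope.
Local Open Scope ring_scope.

(** Both bounds come from adversaries: a first-order map that answers a given
    algorithm identically on an infeasible and on a feasible instance.

    _Bits._ A separating normal may be rescaled by any positive factor, and an
    algorithm with boolean answers is a finite tree, so it reads only finitely
    many binary digits.  An adversary that makes all normals tiny shows zeros at
    all these digits, and only sign bits remain; these do not tell the answer 0
    (the point is feasible) from a tiny positive normal.  Hence the empty set
    looks like the full box, no algorithm solves the problem
    ([bit_oracle_unsolvable]), and the information complexity is infinite.

    _Coordinates._ Take [K], about [Rad / rho], pairwise disjoint intervals of
    length [2 * rho] (cells) in every continuous coordinate.  The adversary hides
    a cube, a product of cells, over one of the [2 ^ n] corners [v] of the unit
    cube of the integer variables, or hides nothing.
    - A query point that is not over a corner has a fractional integer part and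
      can be put into the instance, because convex combinations of such points
      never reach a corner.  The exceptions are points already cut off by an
      earlier normal, which are given that normal again, and points outside the
      bounding region, which are given a coordinate vector.
    - A query point over the corner [v] gets a normal whose integer part points
      out of the unit cube at [v], which separates it from everything that is not
      over [v], plus a tiny multiple of one continuous unit vector [k], which
      separates it from the cubes over [v] on one side.  As long as the direction
      [k] is not asked for, the normal need not be chosen, and all continuous
      coordinates can be answered by 0.

    Let [t] be about [d / 4].  Over each corner, the first [2 * t + 1] continuous
    directions are reserved for cutting and the others for hiding.  A point
    queried [t] times without commitment is resolved at the next query, by
    halving the set of alive cells in a cutting direction not yet asked at that
    point.  Each such cut costs the algorithm [t + 1] queries, and the
    adversary gets stuck only after [(t + 1) * log2 K] of them, so it survives
    about [d ^ 2 * log (Rad / rho)] queries per corner ([respond]).  The points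
    never resolved have [t] unasked hiding directions each, so each of them lies
    in at most a fraction [K ^ - t] of the candidate cubes up to its asked
    directions, and a union bound ([avoid_all]) gives a cube that can be separated
    from all of them ([hide]).  If fewer than [2 ^ n] times that many queries are
    made in total, the adversary survives over some corner ([cheap_corner]), and
    the closed convex hull of the points answered 0, with or without the hidden
    cube, is consistent with all the answers ([coordinate_oracle_bound]). *)

Set Implicit Arguments.
Unset Strict Implicit.
Unset Printing Implicit Defensive.

Local Notation coord := Defs.coord.

(** * The pairing, separation and closed convex hulls *)

Section Dot.
Context {R : realType} {n d : nat}.
Local Notation pt := ('rV[R]_n * 'rV[R]_d)%type.
Implicit Types (g z w : pt) (C S : set pt).

Lemma coord_lshift z i : coord z (lshift d i) = z.1 ord0 i.
Proof. by rewrite /coord row_mxEl. Qed.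

Lemma coord_rshift z k : coord z (rshift n k) = z.2 ord0 k.
Proof. by rewrite /coord row_mxEr. Qed.

Lemma dotE g z : dot g z =
  \sum_i g.1 ord0 i * z.1 ord0 i + \sum_k g.2 ord0 k * z.2 ord0 k.
Proof.
rewrite /dot big_split_ord; congr (_ + _); apply: eq_bigr => i _.
  by rewrite !coord_lshift.
by rewrite !coord_rshift.
Qed.

Lemma coordD z w j : coord (z + w) j = coord z j + coord w j.
Proof. by rewrite /coord -add_row_mx mxE. Qed.

Lemma coordZ (a : R) z j : coord (a *: z) j = a * coord z j.
Proof. by rewrite /coord -scale_row_mx mxE. Qed.

Lemma dotC g z : dot g z = dot z g.
Proof. by apply: eq_bigr => j _; rewrite mulrC. Qed.

Lemma dotDr g z w : dot g (z + w) = dot g z + dot g w.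
Proof. by rewrite -big_split; apply: eq_bigr => j _; rewrite coordD mulrDr. Qed.

Lemma dotZr (a : R) g z : dot g (a *: z) = a * dot g z.
Proof. by rewrite mulr_sumr; apply: eq_bigr => j _; rewrite coordZ mulrCA. Qed.

Lemma dotZl (a : R) g z : dot (a *: g) z = a * dot g z.
Proof. by rewrite dotC dotZr dotC. Qed.

Lemma dotBr g z w : dot g (z - w) = dot g z - dot g w.
Proof. by rewrite dotDr -scaleN1r dotZr mulN1r. Qed.

Lemma dotDl g w z : dot (g + w) z = dot g z + dot w z.
Proof. by rewrite dotC dotDr !(dotC z). Qed.

Lemma dot0l z : dot (0 : pt) z = 0.
Proof. by rewrite -(scale0r (0 : pt)) dotZl mul0r. Qed.

Lemma dotBl g w z : dot (g - w) z = dot g z - dot w z.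
Proof. by rewrite dotC dotBr !(dotC z). Qed.

Lemma dot_sub_sq g w (t : R) : dot (g - t *: w) (g - t *: w) =
  dot g g - 2 * t * dot g w + t ^+ 2 * dot w w.
Proof. by rewrite dotBr !dotBl !(dotZr, dotZl) (dotC w g) expr2; lra. Qed.

Lemma dot_self_gt0 g : g <> 0 -> 0 < dot g g.
Proof.
move=> g0; rewrite lt0r sumr_ge0 ?andbT; last by move=> j _; rewrite -expr2 sqr_ge0.
apply/negP => /eqP /psumr_eq0P g2; apply: g0.
have gj j : coord g j = 0.
  by apply/eqP; rewrite -sqrf_eq0 expr2 g2// => i _; rewrite -expr2 sqr_ge0.
case: g gj {g2} => a b gj; congr pair; apply/rowP => i; rewrite !mxE.
  by have := gj (lshift d i); rewrite coord_lshift.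
by have := gj (rshift n i); rewrite coord_rshift.
Qed.

Lemma coord_cont j : continuous (fun z : pt => coord z j).
Proof.
case: (split_ordP j) => i ->.
  rewrite (_ : (fun _ => _) = (fun M : 'rV[R]_n => M ord0 i) \o fst); last first.
    by apply/funext => z; rewrite coord_lshift.
  by move=> z; apply: continuous_comp; [exact: cvg_fst|exact: coord_continuous].
rewrite (_ : (fun _ => _) = (fun M : 'rV[R]_d => M ord0 i) \o snd); last first.
  by apply/funext => z; rewrite coord_rshift.
by move=> z; apply: continuous_comp; [exact: cvg_snd|exact: coord_continuous].
Qed.

Lemma dot_cont g : continuous (dot g : pt -> R).
Proof.
move=> z; apply: (cvg_big (op := +%R)) => [|j _]; first exact: add_continuous.
by apply: cvgM; [exact: cvg_cst|exact: coord_cont].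
Qed.

Lemma compact_bounded_closed (Rad : R) C : closed C ->
  (forall z, C z -> forall j, `|coord z j| <= Rad) -> compact C.
Proof.
move=> Cc Cb.
pose B m : set 'rV[R]_m := [set v | forall i, `[- Rad, Rad]%classic (v ord0 i)].
have cB m : compact (B m).
  exact: (@rV_compact R m (fun=> `[- Rad, Rad]%classic) (fun=> @segment_compact _ _ _)).
apply: (subclosed_compact Cc (compact_setX (cB n) (cB d))).
move=> z Cz; split => i /=; rewrite in_itv/= -ler_norml.
  by have := Cb _ Cz (lshift d i); rewrite coord_lshift.
by have := Cb _ Cz (rshift n i); rewrite coord_rshift.
Qed.

Lemma convex_segment C z w (t : R) : convex_set C -> C z -> C w ->
  0 <= t <= 1 -> C (w + t *: (z - w)).
Proof.
move=> cC Cz Cw /andP[t0 t1].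
have t01 : Itv.spec (Itv.num_sem (R:=R)) (Itv.Real `[0, 1]%Z) t.
  by rewrite /= /Itv.num_sem /= num_real/= in_itv/= t0 t1.
have := cC z w (Itv.mk t01) (mem_set Cz) (mem_set Cw).
rewrite inE /conv/= /unstable.onem scalerBl scale1r scalerBr.
by rewrite addrCA.
Qed.

(** The normal points from the nearest point [c] of [C] to [zhat]: a point of [C]
    with a larger value of this functional would give a point of [C] closer to
    [zhat] on the segment from [c].  The bound on [C] supplies the compactness
    needed for [c] to exist; the hypothesis on [d] is used for an empty [C], where
    a nonzero vector is still required. *)
Lemma strict_separation (Rad : R) C zhat : (0 < d)%N -> closed C -> convex_set C ->
  (forall z, C z -> forall j, `|coord z j| <= Rad) -> ~ C zhat ->
  exists2 g, g <> 0 & forall z, C z -> dot g z < dot g zhat.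
Proof.
move=> d0 Cc cC Cb nC.
have [C0|/set0P Cn] := eqVneq C set0.
  exists (0, const_mx 1) => [|z]; last by rewrite C0.
  by move=> [] /rowP /(_ (Ordinal d0)); rewrite !mxE => /eqP; rewrite oner_eq0.
have cf : continuous (fun z : pt => dot (zhat - z) (zhat - z)).
  move=> z; apply: (cvg_big (op := +%R)) => [|j _]; first exact: add_continuous.
  have c1 : (fun z : pt => coord (zhat - z) j) @ z --> coord (zhat - z) j.
    rewrite (_ : (fun _ => _) = fun z => coord zhat j - coord z j).
      by rewrite coordD -scaleN1r coordZ mulN1r; apply: cvgB; [exact: cvg_cst|exact: coord_cont].
    by apply/funext => y; rewrite coordD -scaleN1r coordZ mulN1r.
  exact: cvgM.
have [c Cc' cmin] := compact_EVT_min Cn (compact_bounded_closed Cc Cb)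
  (continuous_subspaceT cf).
rewrite inE in Cc'; exists (zhat - c) => [/eqP|z Cz].
  by rewrite subr_eq0 => /eqP zc; apply: nC; rewrite zc.
set g := zhat - c.
have g0 : 0 < dot g g.
  by apply: dot_self_gt0 => /eqP; rewrite subr_eq0 => /eqP zc; apply: nC; rewrite zc.
suff le0 : dot g (z - c) <= 0.
  have -> : dot g zhat = dot g c + dot g g by rewrite -dotDr addrC subrK.
  by move: le0; rewrite dotBr; lra.
rewrite leNgt; apply/negP => gt0.
set u := z - c in gt0.
have key (t : R) : 0 <= t <= 1 -> 2 * t * dot g u <= t ^+ 2 * dot u u.
  move=> t01; have := cmin _ (mem_set (convex_segment cC Cz Cc' t01)).
  by rewrite -/u opprD addrA -/g dot_sub_sq; lra.
have u0 : 0 < dot u u.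
  apply: dot_self_gt0 => u0; move: gt0.
  by rewrite u0 dotC dot0l ltxx.
(* the minimiser of the distance along the line, truncated to the segment *)
have /key : 0 <= Num.min 1 (dot g u / dot u u) <= 1.
  by rewrite ge_min lexx andbT le_min ler01 divr_ge0// ltW.
set t := Num.min _ _.
have t0 : 0 < t by rewrite lt_min ltr01 divr_gt0.
have tu : t * dot u u <= dot g u by rewrite -ler_pdivlMr// ge_min lexx orbT.
have := ler_wpM2l (ltW t0) tu; have := mulr_gt0 t0 gt0.
by rewrite expr2 !mulrA; lra.
Qed.

(** The adversaries prescribe answers for two instances only; this fills in the
    other ones. *)
Lemma first_order_map_exists (Rad rho : R) : (0 < d)%N ->
  exists G : set pt -> pt -> pt, first_order_map Rad rho G.
Proof.
move=> d0.
have ex (Cz : set pt * pt) : exists g : pt, instances Rad rho Cz.1 ->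
    (Cz.1 Cz.2 -> g = 0) /\
    (~ Cz.1 Cz.2 -> g <> 0 /\ forall z, Cz.1 z -> dot g z < dot g Cz.2).
  case: Cz => C zhat /=.
  have [Cz|nCz] := pselect (C zhat); first by exists 0.
  have [CI|] := pselect (instances Rad rho C); last by exists 0.
  case: (CI) => Cc cC Cb _.
  by have [g g0 gs] := strict_separation d0 Cc cC Cb nCz; exists g.
have [G GP] := boolp.choice ex.
by exists (fun C z => G (C, z)) => C CI zhat; exact: (GP (C, zhat)).
Qed.

(** The closed convex hull in its dual form, as an intersection of half-spaces:
    closedness, convexity and separation are then immediate, without convex
    combinations. *)
Definition closed_hull S : set pt :=
  [set z | forall g (b : R), (forall w, S w -> dot g w <= b) -> dot g z <= b].

Lemma sub_closed_hull S : S `<=` closed_hull S.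
Proof. by move=> z Sz g b; apply. Qed.

Lemma closed_hull_mono S T : S `<=` T -> closed_hull S `<=` closed_hull T.
Proof. by move=> ST z zS g b Tb; apply: zS => w /ST; exact: Tb. Qed.

Lemma closed_closed_hull S : closed (closed_hull S).
Proof.
have -> : closed_hull S =
    \bigcap_(gb in [set gb : pt * R | forall w, S w -> dot gb.1 w <= gb.2])
      ((dot gb.1) @^-1` [set x : R | x <= gb.2]).
  apply/seteqP; split => z /=; first by move=> zS [g b] /= Sb; exact: zS.
  by move=> zS g b Sb; exact: (zS (g, b)).
apply: closed_bigI => -[g b] _; apply: closed_comp; last exact: closed_le.
by move=> z _; exact: dot_cont.
Qed.

Lemma convex_closed_hull S : convex_set (closed_hull S).
Proof.
move=> x y t; rewrite !inE => xS yS g b Sb.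
rewrite /conv/= /unstable.onem dotDr !dotZr.
have t0 : 0 <= t%:num by [].
have t1 : 0 <= 1 - t%:num by rewrite subr_ge0.
have := ler_wpM2l t0 (xS _ _ Sb); have := ler_wpM2l t1 (yS _ _ Sb).
by lra.
Qed.

Definition unit_at (j : 'I_(n + d)) : pt :=
  (lsubmx (delta_mx ord0 j), rsubmx (delta_mx ord0 j)).

Lemma coord_unit_at j i : coord (unit_at j) i = (i == j)%:R.
Proof. by rewrite /coord /= hsubmxK mxE. Qed.

Lemma dot_unit_at j z : dot (unit_at j) z = coord z j.
Proof.
rewrite /dot (bigD1 j)//= coord_unit_at eqxx mul1r big1 ?addr0// => i /negPf ij.
by rewrite coord_unit_at ij mul0r.
Qed.

Lemma dot_nunit_at j z : dot (- unit_at j) z = - coord z j.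
Proof. by rewrite -scaleN1r dotZl mulN1r dot_unit_at. Qed.

Lemma closed_hull_bounded (Rad : R) S : (forall z, S z -> forall j, `|coord z j| <= Rad) ->
  forall z, closed_hull S z -> forall j, `|coord z j| <= Rad.
Proof.
move=> Sb z zS j; rewrite ler_norml lerNl -dot_nunit_at -dot_unit_at.
apply/andP; split; apply: zS => w /Sb /(_ j); rewrite ler_norml => /andP[].
  by rewrite dot_nunit_at lerNl.
by rewrite dot_unit_at.
Qed.
End Dot.

(** * Fooling an algorithm; the bit oracle *)

Section Fooling.
Context {R : realType} {n d : nat}.
Local Notation pt := (mipoint R n d).

Lemma le_icomp (Rad rho x : R) (A : Type) (Q : set (pt -> A)) :
  (forall k (alg : algorithm Q), solves_within Rad rho k alg -> x <= k%:R) ->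
  (x%:E <= icomp Rad rho Q)%E.
Proof.
move=> xk; apply: le_ereal_inf_tmp => _ [k [alg sol] <-].
by rewrite lee_fin; exact: xk sol.
Qed.

(** A report that is correct for both instances would be at once a point and the
    claim that there is none. *)
Lemma indistinguishable_not_solved (Rad rho : R) (A : Type) (Q : set (pt -> A)) k
    (alg : algorithm Q) G C1 C2 :
  first_order_map Rad rho G -> instances Rad rho C1 -> instances Rad rho C2 ->
  C1 `&` mixed_integer !=set0 -> C2 `&` mixed_integer = set0 ->
  (run (oracle G C1) alg).1 = (run (oracle G C2) alg).1 -> ~ solves_within Rad rho k alg.
Proof.
move=> GP I1 I2 F1 F2 runE sol.
have [c1 _] := sol _ GP _ I1; have [c2 _] := sol _ GP _ I2.
move: c1 c2; rewrite runE; case: (run _ _).1 => [z _ c2|c1 _].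
  by have : (C2 `&` mixed_integer) z by []; rewrite F2.
by case/set0P/eqP: F1.
Qed.

Lemma instances_set0 (Rad rho : R) : instances Rad rho (set0 : set pt).
Proof.
split => //; first exact: closed0.
by rewrite set0I => /set0P; rewrite eqxx.
Qed.

Lemma norm_ball_coord (m : nat) (y c : 'rV[R]_m) (rho : R) k :
  `|y - c| <= rho -> `|y ord0 k - c ord0 k| <= rho.
Proof.
move=> yc; apply: le_trans yc; rewrite [leRHS]/Num.norm/= mx_normrE.
apply: (le_trans _ (le_bigmax _ _ (ord0, k))) => /=.
by rewrite !mxE.
Qed.

Definition box (Rad : R) : set pt := [set z | forall j, `|coord z j| <= Rad].

Lemma instances_box (Rad rho : R) : 0 < rho -> rho <= Rad -> instances Rad rho (box Rad).
Proof.
move=> rho0 rhoR.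
have E : box Rad = closed_hull (box Rad).
  by apply/seteqP; split; [exact: sub_closed_hull|exact: closed_hull_bounded].
split => //; first by rewrite E; exact: closed_closed_hull.
  by rewrite E; exact: convex_closed_hull.
move=> _; exists 0, 0; split.
  by apply/mxOverP => i j; rewrite mxE.
move=> _ [y /= yrho <-] j; case: (split_ordP j) => i ->.
  by rewrite coord_lshift mxE normr0 (le_trans (ltW rho0)).
by rewrite coord_rshift (le_trans _ rhoR)//; have := norm_ball_coord i yrho; rewrite mxE subr0.
Qed.

Lemma box_feasible (Rad : R) : 0 <= Rad -> box Rad `&` mixed_integer !=set0.
Proof.
move=> R0; exists (0, 0); split => /=; last by apply/mxOverP => i j; rewrite mxE.
by move=> j; rewrite /Defs.coord/= row_mx0 mxE normr0.
Qed.

Lemma bit_small (i : int) (r : R) : `|r| < 2 ^ i -> bit (Some i) r = false.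
Proof.
move=> ri; rewrite /bit.
have -> : Num.floor (`|r| / 2 ^ i) = 0; last by [].
apply/eqP; rewrite eq_le floor_le0 floor_ge0 divr_ge0 ?exprz_ge0// andbT.
by rewrite ltr_pdivrMr ?exprz_gt0// mul1r.
Qed.

(** The tree is finitely branching, hence finite, which is why one [eps] lies below
    the weights of all the digits that it may read. *)
Lemma bit_queries_see_only_signs (alg : algorithm (@Qbit R n d)) :
  exists2 eps : R, 0 < eps & forall f1 f2 : pt -> pt,
    (forall z j, `|coord (f1 z) j| < eps) -> (forall z j, `|coord (f2 z) j| < eps) ->
    (forall z j, (coord (f1 z) j < 0) = (coord (f2 z) j < 0)) ->
    run (fun z (q : @Qbit R n d) => val q (f1 z)) alg =
    run (fun z (q : @Qbit R n d) => val q (f2 z)) alg.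
Proof.
elim: alg => [res|z q next IH]; first by exists 1.
have [e1 e1_gt0 H1] := IH true; have [e2 e2_gt0 H2] := IH false.
have [i [j qE]] : Qbit (val q) by exact: (set_mem (valP q)).
pose e0 : R := if i is Some i then 2 ^ i else 1.
have e0_gt0 : 0 < e0 by rewrite /e0; case: (i) => // m; rewrite exprz_gt0.
exists (Num.min e0 (Num.min e1 e2)); first by rewrite !lt_min e0_gt0 e1_gt0.
move=> f1 f2 f1e f2e f12 /=.
have -> : val q (f1 z) = val q (f2 z).
  rewrite qE; change (bit i (coord (f1 z) j) = bit i (coord (f2 z) j)).
  move: (f1e z j) (f2e z j) (f12 z j); rewrite /e0; case: (i) => [m|//].
  by rewrite !lt_min => /andP[a _] /andP[b _] _; rewrite !bit_small.
suff -> : run (fun z (q : @Qbit R n d) => val q (f1 z)) (next (val q (f2 z))) =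
  run (fun z (q : @Qbit R n d) => val q (f2 z)) (next (val q (f2 z))) by [].
case: (val q (f2 z)); [apply: H1|apply: H2] => // w l;
  by [move: (f1e w l); rewrite !lt_min => /and3P[]|move: (f2e w l); rewrite !lt_min => /and3P[]].
Qed.

(** On the empty instance the map imitates the box, but answers the tiny positive
    vector [p] where the box answers 0; both have only false bits. *)
Lemma bit_oracle_unsolvable (Rad rho : R) k (alg : algorithm (@Qbit R n d)) :
  (0 < d)%N -> 0 < rho -> rho <= Rad -> ~ solves_within Rad rho k alg.
Proof.
move=> d0 rho0 rhoR.
have [eps eps0 fool] := bit_queries_see_only_signs alg.
have [G0 G0P] := @first_order_map_exists R n d Rad rho d0.
(* rescaling that brings all coordinates of a normal below eps *)
pose s (g : pt) := eps / (1 + \sum_j `|coord g j|).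
have s0 g : 0 < s g by rewrite divr_gt0// ltr_pwDl// sumr_ge0.
pose sc (g : pt) : pt := s g *: (g : 'rV[R]_n * 'rV[R]_d).
have sc_small g j : `|coord (sc g) j| < eps.
  rewrite coordZ normrM gtr0_norm// mulrAC ltr_pdivrMr; last by rewrite ltr_pwDl// sumr_ge0.
  rewrite ltr_pM2l// (bigD1 j)//= addrCA ltrDl ltr_pwDl//; exact: sumr_ge0.
pose B := box Rad.
pose p : pt := (0, const_mx (eps / 2)).
pose G (C : set pt) z := if `[< C = set0 >] then
  (if `[< B z >] then p else sc (G0 B z)) else sc (G0 C z).
have IB : instances Rad rho B by exact: instances_box.
have B0 : B <> set0.
  by move=> B0; have := box_feasible (le_trans (ltW rho0) rhoR); rewrite -/B B0 set0I => -[].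
have sc_neq0 g : g <> (0, 0) -> sc g <> (0, 0).
  move=> g0 /eqP; rewrite scaler_eq0 gt_eqF//= => /eqP; exact: g0.
have p0 : p <> (0, 0).
  by case=> /rowP /(_ (Ordinal d0)); rewrite !mxE => /eqP; rewrite gt_eqF// divr_gt0.
have GP : first_order_map Rad rho G.
  move=> C CI z; rewrite /G; case: asboolP => [C0|C0].
    split; first by rewrite C0.
    move=> _; split; last by rewrite C0.
    case: asboolP => // nBz; apply: sc_neq0; exact: ((G0P B IB z).2 nBz).1.
  have [h1 h2] := G0P C CI z; split => [Cz|nCz].
    by rewrite h1// /sc scaler0.
  have [h3 h4] := h2 nCz; split; first exact: sc_neq0.
  by move=> w Cw; rewrite !dotZl ltr_pM2l//; exact: h4.
apply: (indistinguishable_not_solved GP IB (@instances_set0 Rad rho)).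
- exact/box_feasible/(le_trans (ltW rho0)).
- exact: set0I.
have p_coord j : 0 <= coord p j < eps.
  case: (split_ordP j) => i ->; rewrite ?coord_lshift ?coord_rshift !mxE.
    by rewrite lexx.
  by apply/andP; split; lra.
congr fst; apply: fool => z j.
- by rewrite /G; case: asboolP.
- rewrite /G; case: asboolP => // _; case: asboolP => // _.
  by case/andP: (p_coord j) => *; rewrite ger0_norm.
rewrite /G; case: asboolP => // _; case: asboolP => // _.
case: asboolP => // Bz; rewrite (G0P B IB z).1// /sc scaler0.
have -> : coord (0 : 'rV[R]_n * 'rV[R]_d) j = 0 by rewrite /Defs.coord row_mx0 mxE.
by rewrite ltxx ltNge; case/andP: (p_coord j) => ->.
Qed.
End Fooling.

(** * Cells and the union bound *)

Section Cells.
Context {R : realType} {K : nat}.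
Variables (rho : R) (c : 'I_K -> R).
Hypothesis c_sep : forall i j : 'I_K, (i < j)%N -> c i + rho < c j - rho.

Lemma card_cells_around (y : R) :
  (#|[set i : 'I_K | (y - c i <= rho)%R && (c i - y <= rho)%R]%SET| <= 1)%N.
Proof.
apply/card_le1P => i; rewrite inE => /andP[i1 i2] j; rewrite !inE.
apply/idP/eqP => [/andP[j1 j2]|->]; last by rewrite i1.
apply/val_inj; have [ij|ij|//] := ltngtP i j.
  by exfalso; have := c_sep ij; lra.
by exfalso; have := c_sep ij; lra.
Qed.

(** The coordinate [y] of a query point meets at most one of the alive cells; of
    the cells entirely on either side of it, one side has nearly half.  Rounding
    is harmless because the cardinal is at least a power of two. *)
Lemma halve_cells (S : {set 'I_K}) (y : R) m : (2 ^ m.+1 <= #|S|)%N ->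
  exists (s : R) (S' : {set 'I_K}), [/\ S' \subset S, (2 ^ m <= #|S'|)%N, `|s| = 1 &
    forall i x, i \in S' -> `|x - c i| <= rho -> s * x < s * y].
Proof.
move=> Sm.
pose L := [set i in S | y < c i - rho]%SET; pose U := [set i in S | c i + rho < y]%SET.
have SLU : (#|S| <= #|L| + #|U| + 1)%N.
  apply: leq_trans (leq_add (leqnn _) (card_cells_around y)).
  apply: leq_trans (leq_add (leq_card_setU _ _) (leqnn _)).
  apply: leq_trans (leq_card_setU _ _); apply/subset_leq_card/fintype.subsetP => i iS.
  rewrite !inE iS/=.
  case: (ltP y (c i - rho)) => //= h1; case: (ltP (c i + rho) y) => //= h2.
  by apply/andP; split; lra.
have [Lm|Lm] := leqP (2 ^ m) #|L|.
  exists (-1), L; split=> //; first by apply/fintype.subsetP => i; rewrite inE => /andP[].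
    by rewrite normrN1.
  by move=> i x; rewrite inE => /andP[_ iy]; rewrite ler_norml => /andP[]; lra.
exists 1, U; split=> //; first by apply/fintype.subsetP => i; rewrite inE => /andP[].
- by move: Sm SLU Lm; rewrite expnS; lia.
- by rewrite normr1.
by move=> i x; rewrite inE => /andP[_ iy]; rewrite ler_norml => /andP[]; lra.
Qed.
End Cells.

(** A uniformly random [b] satisfies [P z k (b k)] for all [k] in [F z] with
    probability at most [K ^ - t], so fewer than [K ^ t] constraints cannot cover
    all choices of [b]. *)
Lemma avoid_all (T : eqType) (d K t : nat) (zs : seq T) (F : T -> {set 'I_d})
    (P : T -> 'I_d -> pred 'I_K) :
  (0 < K)%N -> (forall z, z \in zs -> (t <= #|F z|)%N) ->
  (forall z k, (#|P z k| <= 1)%N) -> (size zs < K ^ t)%N ->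
  exists b : {ffun 'I_d -> 'I_K}, forall z, z \in zs ->
    exists2 k, k \in F z & ~~ P z k (b k).
Proof.
move=> K0 Ft P1 zt.
pose bad z (b : {ffun 'I_d -> 'I_K}) := [forall k in F z, P z k (b k)].
suff [b /hasPn bP] : exists b, ~~ has (bad^~ b) zs.
  exists b => z /bP; rewrite negb_forall => /existsP[k].
  by rewrite negb_imply => /andP[kF kP]; exists k.
apply/existsP; rewrite -negb_forall; apply/negP => /forallP allbad.
have b0 : {ffun 'I_d -> 'I_K} := [ffun=> Ordinal K0].
have [z0 z0zs _] := hasP (allbad b0).
have td : (t <= d)%N.
  by rewrite (leq_trans (Ft _ z0zs))// (leq_trans (max_card _))// card_ord.
have bad_card z : z \in zs -> (#|[pred b | bad z b]| <= K ^ (d - t))%N.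
  move=> zzs.
  pose fam k : pred 'I_K := if k \in F z then P z k else predT.
  have -> : #|[pred b | bad z b]| = #|(family fam : pred {ffun 'I_d -> 'I_K})|.
    apply: eq_card => b; rewrite !inE; apply/forallP/familyP => [h k|h k].
      by rewrite /fam; have /implyP := h k; case: ifP => // _ /(_ isT).
    by apply/implyP => kF; have := h k; rewrite /fam kF.
  rewrite card_family foldrE big_map big_enum /=.
  have le1 k : (#|fam k| <= if k \notin F z then K else 1)%N.
    by rewrite /fam; case: ifP => //= _; rewrite cardT size_enum_ord.
  apply: (leq_trans (leq_prod (fun k _ => le1 k))).
  rewrite -big_mkcond /= prod_nat_const leq_pexp2l//.
  have FC : (#|F z| + #|[predC F z]| = d)%N by rewrite cardC card_ord.
  rewrite (eq_card (_ : _ =i [predC F z])); last by move=> k; rewrite !inE.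
  by rewrite -[X in (_ <= X - _)%N]FC leq_subRL ?(leq_trans (Ft _ zzs)) ?leq_addr// leq_add2r Ft.
have : (#|{: {ffun 'I_d -> 'I_K}}| <= \sum_(z <- zs) #|[pred b | bad z b]|)%N.
  rewrite -sum1_card (eq_bigr (fun z => \sum_b bad z b)%N) => [|z _].
    rewrite exchange_big /=; apply: leq_sum => b _.
    have [z zzs zb] := hasP (allbad b).
    by rewrite (big_rem z)//= zb.
  by rewrite -sum1_card big_mkcond.
apply/negP; rewrite -ltnNge big_seq_cond.
apply: (@leq_ltn_trans (\sum_(z <- zs | (z \in zs) && true) K ^ (d - t))%N).
  by apply: leq_sum => z /andP[zzs _]; exact: bad_card.
rewrite -big_seq_cond big_const_seq count_predT iter_addn_0 mulnC.
rewrite card_ffun !card_ord -(subnKC td) [X in (_ < X)%N]expnD addKn.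
by rewrite ltn_pmul2r// expn_gt0 K0.
Qed.

(** * Normals over the corners of the unit cube *)

Section Normals.
Context {R : realType} {n d : nat}.
Local Notation pt := ('rV[R]_n * 'rV[R]_d)%type.
Implicit Types (v : {ffun 'I_n -> bool}) (z w : pt) (W : seq pt).

Definition vert v : 'rV[R]_n := \row_i (v i)%:R.

Lemma vert_inj : injective vert.
Proof.
move=> v v' /rowP E; apply/ffunP => i; have /eqP := E i.
by rewrite !mxE eqr_nat; case: (v i); case: (v' i).
Qed.

(** At a corner of the unit cube, this is the vector of signs whose maximum over
    the cube is attained at that corner only. *)
Definition outward z : pt := (\row_i (2 * z.1 ord0 i - 1), 0).

Lemma dot_outward z w :
  dot (outward z) w = \sum_i (2 * z.1 ord0 i - 1) * w.1 ord0 i.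
Proof.
rewrite dotE /= [X in _ + X]big1 ?addr0 => [|k _]; last by rewrite mxE mul0r.
by apply: eq_bigr => i _; rewrite mxE.
Qed.

Lemma dot_outward_vert v y w : dot (outward (vert v, y)) (vert v, y) - dot (outward (vert v, y)) w =
  \sum_i (if v i then 1 - w.1 ord0 i else w.1 ord0 i).
Proof.
rewrite !dot_outward -sumrB; apply: eq_bigr => i _ /=.
by rewrite mxE; case: (v i) => /=; lra.
Qed.

Definition in_cube (x : 'rV[R]_n) := forall i, 0 <= x ord0 i <= 1.

Lemma outward_separates v y w : in_cube w.1 -> w.1 <> vert v ->
  dot (outward (vert v, y)) w < dot (outward (vert v, y)) (vert v, y).
Proof.
move=> w01 wv; rewrite -subr_gt0 dot_outward_vert.
have ge0 i : 0 <= (if v i then 1 - w.1 ord0 i else w.1 ord0 i).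
  by have := w01 i; case: (v i); lra.
rewrite lt0r sumr_ge0// andbT; apply/negP => /eqP /psumr_eq0P s0; apply: wv.
apply/rowP => i; rewrite mxE; have := s0 (fun i _ => ge0 i) i isT.
by case: (v i) => /=; lra.
Qed.

Lemma in_cube_vert v : in_cube (vert v).
Proof. by move=> i; rewrite mxE; case: (v i) => /=; rewrite !lexx ler01. Qed.

(** The gap is uniform over the other corners, so it survives a small tilt whatever
    cubes lie over them. *)
Lemma outward_separates_vert v v' y w : w.1 = vert v' -> v' <> v ->
  dot (outward (vert v, y)) w + 1 <= dot (outward (vert v, y)) (vert v, y).
Proof.
move=> wv' vv'; rewrite -lerBrDl dot_outward_vert wv'.
have /existsP[i iv] : [exists i, v i != v' i].
  rewrite -negb_forall; apply/negP => /forallP E; apply: vv'; apply/ffunP => i.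
  by have /eqP := E i.
rewrite (bigD1 i)//= -[X in X <= _]addr0 lerD//.
  by rewrite mxE; move: iv; case: (v i); case: (v' i) => //=; lra.
apply: sumr_ge0 => l _; rewrite mxE; case: (v l); case: (v' l) => /=; lra.
Qed.

(** The coefficient [e] carries the sign of the cut and is small, so that the gap of
    [outward] decides except over the corner of [z], where the direction [k]
    decides. *)
Definition tilt z k (e : R) : pt := outward z + e *: unit_at (rshift n k).

Lemma dot_tilt z k e w : dot (tilt z k e) w = dot (outward z) w + e * w.2 ord0 k.
Proof. by rewrite dotDl dotZl dot_unit_at coord_rshift. Qed.

Lemma coord_tilt z k e j : j <> rshift n k -> coord (tilt z k e) j = coord (outward z) j.
Proof. by move=> /eqP/negPf jk; rewrite coordD coordZ coord_unit_at jk mulr0 addr0. Qed.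

Lemma outward_gap v y W : (forall w, w \in W -> in_cube w.1 /\ w.1 <> vert v) ->
  exists2 e : R, 0 < e <= 1 & forall w, w \in W ->
    dot (outward (vert v, y)) w + e <= dot (outward (vert v, y)) (vert v, y).
Proof.
elim: W => [|w W IH] Wv; first by exists 1; rewrite ?ltr01 ?lexx.
have [|e /andP[e0 e1] eP] := IH; first by move=> w' w'W; apply: Wv; rewrite inE w'W orbT.
have [w01 wv] := Wv w (mem_head _ _).
have := outward_separates y w01 wv.
set a := dot _ w; set b := dot _ _ => ab.
exists (Num.min e (b - a)).
  by rewrite lt_min e0 subr_gt0 ab ge_min e1.
move=> w'; rewrite inE => /predU1P[->|/eP].
  by rewrite -/a -lerBrDl ge_min lexx orbT.
by apply: le_trans; rewrite lerD2l ge_min lexx.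
Qed.

(** The gap of [outward z] over finitely many points is positive, and the tilt
    changes the pairing by at most [`|e| * (`|y k| + Rad)]. *)
Lemma tilt_separates v y k (s Rad : R) W : `|s| = 1 -> 0 <= Rad ->
  (forall w, w \in W -> in_cube w.1 /\ w.1 <> vert v) ->
  exists e : R,
    let g := tilt (vert v, y) k e in
    forall w, `|w.2 ord0 k| <= Rad ->
      w \in W \/ (exists v', w.1 = vert v' /\ (v' = v -> s * w.2 ord0 k < s * y ord0 k)) ->
      dot g w < dot g (vert v, y).
Proof.
move=> s1 Rad0 Wv.
have [gap /andP[gap0 gap1] gapP] := outward_gap y Wv.
pose m := `|y ord0 k| + Rad.
have m0 : 0 <= m by rewrite addr_ge0.
pose e0 := gap / (1 + m).
have e00 : 0 < e0 by rewrite divr_gt0// ltr_pwDl.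
have e0m : e0 * m < gap by rewrite mulrAC ltr_pdivrMr ?ltr_pwDl// ltr_pM2l//; lra.
exists (e0 * s) => g w wk wP; rewrite !dot_tilt /=.
have [[v' [wv' lts]]|far] : (exists v', w.1 = vert v' /\ (v' = v /\ s * w.2 ord0 k < s * y ord0 k))
    \/ dot (outward (vert v, y)) w + gap <= dot (outward (vert v, y)) (vert v, y).
- case: wP => [/gapP|[v' [wv' lts]]]; first by right.
  have [E|/eqP E] := eqVneq v' v; first by left; exists v'; split=> //; split => //; exact: lts.
  by right; apply: le_trans (outward_separates_vert y wv' E); rewrite lerD2l.
- case: lts => E lts; rewrite !dot_outward wv' E /= ltrD2l -![e0 * s * _]mulrA ltr_pM2l//.
have : e0 * s * (w.2 ord0 k - y ord0 k) <= e0 * m.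
  rewrite -mulrA ler_pM2l// (le_trans (ler_norm _))// normrM s1 mul1r.
  by rewrite (le_trans (ler_normB _ _))// addrC lerD2l.
by lra.
Qed.

Definition fractional (Rad : R) w :=
  [/\ in_cube w.1, forall v, w.1 <> vert v & forall k, `|w.2 ord0 k| <= Rad].
End Normals.

(** * The adversary for the coordinate oracle *)

Section Adversary.
Context {R : realType} {n d : nat}.
Local Notation pt := ('rV[R]_n * 'rV[R]_d)%type.
Local Notation corner := {ffun 'I_n -> bool}.
Variables (Rad rho : R) (K t H : nat) (c : 'I_K -> R).
Hypothesis Rad_ge0 : 0 <= Rad.
Hypothesis c_bound : forall i, `|c i| + rho <= Rad.
Hypothesis c_sep : forall i j : 'I_K, (i < j)%N -> c i + rho < c j - rho.
Hypothesis t_lt : (4 * t < d)%N.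
Implicit Types (v : corner) (z w : pt) (h : seq (pt * 'I_(n + d) * R)).

(** The adversary's knowledge: the points placed in the instance (answer 0), the
    normals already fixed, the queries at corner points whose normal is still
    open, and, over each corner and direction, the cells still possible for the
    hidden cube with the number of cuts made. *)
Record state := State {
  zeros : seq pt;
  normal : pt -> option pt;
  pending : seq (pt * 'I_(n + d));
  alive : corner -> 'I_d -> {set 'I_K};
  cuts : corner -> 'I_d -> nat }.
Implicit Type s : state.

(** The points that the final instance may contain; every fixed normal has to
    separate its point from them. *)
Definition live s w := w \in zeros s \/
  exists v, w.1 = vert v /\
    forall k, exists2 i, i \in alive s v k & `|w.2 ord0 k - c i| <= rho.

Definition at_point z (e : pt * 'I_(n + d)) := e.1 == z.
Definition over_corner v (e : pt * 'I_(n + d)) := e.1.1 == vert v.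

Definition visits v h := count (fun e => over_corner v e.1) h.

(** Corners over which the adversary still has budget.  Over the other corners it
    only keeps its past answers consistent, for a cube hidden elsewhere. *)
Definition cheap v h := (4 * visits v h < t.+1 ^ 2 * H)%N.

Definition answered s z j r :=
  [\/ z \in zeros s /\ r = 0,
      exists2 g, normal s z = Some g & r = coord g j |
      (z, j) \in pending s /\ r = coord (outward z) j].

(** In [valid_budget], a cut accounts for the [t.+1] queries made at the point that
    caused it, and an open query accounts for itself; this is what makes cuts
    expensive. *)
Record valid h s : Prop := Valid {
  valid_answered : forall z j r, (z, j, r) \in h -> answered s z j r;
  valid_zeros : forall w, w \in zeros s -> fractional Rad w;
  valid_normal : forall z g, normal s z = Some g -> forall w, live s w -> dot g w < dot g z;
  valid_pending : forall z j, (z, j) \in pending s -> normal s z = None /\ exists v, z.1 = vert v;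
  valid_cuts : forall v k, (cuts s v k <= H)%N;
  valid_alive : forall v k, (2 ^ (H - cuts s v k) <= #|alive s v k|)%N;
  valid_uncut : forall v (k : 'I_d), (t.*2 < k)%N -> alive s v k = [set: 'I_K]%SET;
  valid_budget : forall v, cheap v h ->
    (t.+1 * (\sum_k cuts s v k) + count (over_corner v) (pending s)
      <= visits v h)%N;
  valid_light : forall v, cheap v h -> forall z, z.1 = vert v ->
    (count (at_point z) (pending s) <= t)%N }.

Lemma cheap_cons v e h : cheap v (e :: h) -> cheap v h.
Proof. by rewrite /cheap /visits /=; case: (over_corner _ _) => /=; lia. Qed.

Lemma visits_cons v e h : (visits v h <= visits v (e :: h))%N.
Proof. exact: leq_addl. Qed.

Lemma live_bounded h s w : valid h s -> live s w ->
  in_cube w.1 /\ forall k, `|w.2 ord0 k| <= Rad.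
Proof.
move=> vs [/(valid_zeros vs)[w01 _ wR]|[v [-> wk]]]; first by split.
split; first exact: in_cube_vert.
move=> k; have [i _ ik] := wk k.
have := ler_normD (w.2 ord0 k - c i) (c i); rewrite subrK.
by have := c_bound i; lra.
Qed.

Lemma valid_init : (2 ^ H <= K)%N ->
  valid [::] (State [::] (fun=> None) [::] (fun _ _ => [set: 'I_K]%SET) (fun _ _ => 0%N)).
Proof.
move=> HK; split=> //= *; last by rewrite /visits big1 // muln0.
by rewrite subn0 cardsT card_ord.
Qed.

Lemma valid_keep h s z j r : valid h s -> answered s z j r -> valid ((z, j, r) :: h) s.
Proof.
case=> a1 a2 a3 a4 a5 a6 a7 a8 a9 a; split=> //.
- by move=> z' j' r'; rewrite inE => /predU1P[[-> -> ->]|/a1].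
- by move=> v /[dup] /cheap_cons /a8 /leq_trans le _; apply: le; exact: visits_cons.
- by move=> v /cheap_cons /a9.
Qed.

Lemma valid_add_zero h s z : valid h s -> fractional Rad z -> 
  (forall z' g, normal s z' = Some g -> dot g z < dot g z') ->
  valid h (State (z :: zeros s) (normal s) (pending s) (alive s) (cuts s)).
Proof.
case=> a1 a2 a3 a4 a5 a6 a7 a8 a9 fz zn; split=> //=.
- move=> z' j r /a1[[zz r0]|ex|pend]; [|exact: Or32|exact: Or33].
  by apply: Or31; rewrite /= inE zz orbT.
- by move=> w; rewrite inE => /predU1P[->|/a2].
- move=> z' g z'g w [|lw]; last by apply: (a3 _ _ z'g); right.
  rewrite inE => /predU1P[->|wz]; first exact: zn z'g.
  by apply: (a3 _ _ z'g); left.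
Qed.

Definition set_normal s z g :=
  State (zeros s) (fun w => if w == z then Some g else normal s w) (pending s) (alive s) (cuts s).

Lemma valid_set_normal h s z g : valid h s -> normal s z = None ->
  (forall v, z.1 <> vert v) -> (forall w, live s w -> dot g w < dot g z) ->
  valid h (set_normal s z g).
Proof.
case=> a1 a2 a3 a4 a5 a6 a7 a8 a9 nz zv sep; split=> //=.
- move=> z' j r /a1[zz|[g' z'g' rg]|pend]; [exact: Or31| |exact: Or33].
  apply: Or32; exists g' => //=; case: eqP => // zz.
  by rewrite zz nz in z'g'.
- by move=> z' g'; case: eqP => [-> [<-]|_ /a3].
- move=> z' j /a4[z'n [v z'v]]; split; last by exists v.
  by case: eqP => // zz; case: (zv v); rewrite -zz.
Qed.

(** A point violating a fixed normal reuses it, which excludes nothing new; a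
    fractional point violating none of them joins the instance; a point outside the
    bounding region is separated from all of it by a coordinate vector. *)
Lemma respond_off_corners h s z j : valid h s -> z \notin zeros s ->
  normal s z = None -> (forall v, z.1 <> vert v) ->
  exists r s', valid ((z, j, r) :: h) s'.
Proof.
move=> vs zz nz zv.
have use g : (forall w, live s w -> dot g w < dot g z) ->
    exists r s', valid ((z, j, r) :: h) s'.
  move=> sep; exists (coord g j), (set_normal s z g); apply: valid_keep.
    exact: valid_set_normal.
  by apply: Or32; exists g => //=; rewrite eqxx.
have [[z' [g [z'g le]]]|nviol] := pselect (exists z' g,
    normal s z' = Some g /\ dot g z' <= dot g z).
  apply: (use g) => w lw; exact: lt_le_trans (valid_normal vs z'g lw) le.
have [fz|nfz] := pselect (fractional Rad z).
  exists 0, (State (z :: zeros s) (normal s) (pending s) (alive s) (cuts s)).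
  apply: valid_keep; last by apply: Or31; rewrite /= mem_head.
  apply: valid_add_zero => // z' g z'g; rewrite ltNge; apply/negP => le.
  by apply: nviol; exists z', g.
have [j0 [sgn [b [zb lb]]]] : exists j0 (sgn b : R), b < sgn * coord z j0 /\
    forall w, live s w -> sgn * coord w j0 <= b.
  have [z01|nz01] := pselect (in_cube z.1).
    have /existsNP[k /negP] : ~ forall k, `|z.2 ord0 k| <= Rad by move=> zk; apply: nfz.
    rewrite -ltNge ltr_normr => /orP[] zk.
      exists (rshift n k), 1, Rad; rewrite mul1r coord_rshift.
      split=> // w /(live_bounded vs)[_ /(_ k)].
      by rewrite mul1r coord_rshift ler_norml => /andP[].
    exists (rshift n k), (-1), Rad; rewrite mulN1r coord_rshift.
    split=> // w /(live_bounded vs)[_ /(_ k)].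
    by rewrite mulN1r coord_rshift ler_norml lerNl => /andP[].
  move/existsNP: nz01 => [i /negP]; rewrite negb_and -!ltNge => /orP[] zi.
    exists (lshift d i), (-1), 0; rewrite mulN1r coord_lshift oppr_gt0.
    split=> // w /(live_bounded vs)[/(_ i) /andP[w0 _] _].
    by rewrite mulN1r coord_lshift oppr_le0.
  exists (lshift d i), 1, 1; rewrite mul1r coord_lshift.
  split=> // w /(live_bounded vs)[/(_ i) /andP[_ w1] _].
  by rewrite mul1r coord_lshift.
apply: (use (sgn *: unit_at j0)) => w /lb wb.
by rewrite !dotZl !dot_unit_at; exact: le_lt_trans wb zb.
Qed.

(** Postponing the choice of the normal: the answers of [outward z] agree with those
    of every later tilt in a direction not asked at [z]. *)
Lemma valid_pend h s z j v : valid h s -> normal s z = None -> z.1 = vert v ->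
  (cheap v ((z, j, coord (outward z) j) :: h) ->
     count (at_point z) (pending s) < t)%N ->
  valid ((z, j, coord (outward z) j) :: h)
    (State (zeros s) (normal s) ((z, j) :: pending s) (alive s) (cuts s)).
Proof.
case=> a1 a2 a3 a4 a5 a6 a7 a8 a9 nz zv lt; split=> //=.
- move=> z' j' r; rewrite inE => /predU1P[[-> -> ->]|/a1[zz|ex|[pend rE]]].
  + by apply: Or33; rewrite /= mem_head.
  + exact: Or31.
  + exact: Or32.
  + by apply: Or33; rewrite /= inE pend orbT.
- move=> z' j'; rewrite inE => /predU1P[[-> _]|/a4//]; split=> //; by exists v.
- by move=> v' /cheap_cons /a8; rewrite /visits /=; lia.
- move=> v' ch z' z'v'; rewrite {1}/at_point /=; case: eqP => [zz|_].
    have vv : v = v' by apply: (@vert_inj R n); rewrite -zv zz z'v'.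
    by rewrite add1n -zz; apply: lt; rewrite vv.
  exact: a9 (cheap_cons ch) _ z'v'.
Qed.

(** Committing: the direction [k] has not been asked at [z], so the tilted normal
    agrees with the past answers at [z].  The open queries at [z], at least [t] of
    them, are released and pay together with the current one for the cut. *)
Lemma valid_cut h s z j v (k : 'I_d) : valid h s -> normal s z = None -> z.1 = vert v ->
  (t <= count (at_point z) (pending s))%N ->
  (k < t.*2.+1)%N -> (z, rshift n k) \notin pending s -> (cuts s v k < H)%N ->
  exists r s', valid ((z, j, r) :: h) s'.
Proof.
move=> vs nz zv tz kt kz ck.
have [a1 a2 a3 a4 a5 a6 a7 a8 a9] := vs.
have [sgn [S' [S'S S'm sgn1 S'P]]] : exists (sgn : R) (S' : {set 'I_K}),
    [/\ S' \subset alive s v k, (2 ^ (H - (cuts s v k).+1) <= #|S'|)%N, `|sgn| = 1 &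
    forall i x, i \in S' -> `|x - c i| <= rho -> sgn * x < sgn * z.2 ord0 k].
  by apply: (halve_cells c_sep); rewrite subnSK.
have Wv w : w \in zeros s -> in_cube w.1 /\ w.1 <> vert v by move=> /a2[].
have [e eP] := tilt_separates z.2 k sgn1 Rad_ge0 Wv.
set g := tilt _ _ _ in eP.
pose upd T (f : corner -> 'I_d -> T) x v' k' := if (v' == v) && (k' == k) then x else f v' k'.
pose s' := State (zeros s) (fun w => if w == z then Some g else normal s w)
  [seq e <- pending s | ~~ at_point z e] (upd _ (alive s) S') (upd _ (cuts s) (cuts s v k).+1).
have zE : z = (vert v, z.2) by rewrite -zv; case: (z).
have ls w : live s' w -> live s w.
  case=> [|[v' [wv' wk']]]; first by left.
  right; exists v'; split=> // k'; have [i] := wk' k'.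
  rewrite /= /upd; case: ifP => [/andP[/eqP-> /eqP->] iS|_]; last by exists i.
  by exists i => //; exact: (fintype.subsetP S'S).
have count_v v' : (count (over_corner v') [seq e <- pending s | ~~ at_point z e] +
    (v' == v) * t <= count (over_corner v') (pending s))%N.
  rewrite -[leqRHS]size_filter -(count_predC (predC (at_point z))) !count_filter.
  apply: leq_add; first by apply/eq_leq/eq_count => x; rewrite /= andbC.
  case: eqP => [->|_]; last by rewrite mul0n.
  rewrite mul1n; apply: leq_trans tz _; apply: sub_count => x /= /eqP xz.
  by rewrite negbK /over_corner xz zv eqxx /at_point xz eqxx.
have sum_cuts v' : (\sum_k' cuts s' v' k' = \sum_k' cuts s v' k' + (v' == v))%N.
  rewrite /s' /upd /=; case: eqP => [->|_]; last by rewrite addn0.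
  rewrite (bigD1 k)//= [in RHS](bigD1 k)//= eqxx addn1 addSn; congr (_ + _).+1%N.
  by apply: eq_bigr => k' /negPf ->.
exists (coord g j), s'; split=> //=.
- move=> z' j' r; rewrite inE => /predU1P[[-> -> ->]|/a1[zz|[g' z'g' rg]|[pend rE]]].
  + by apply: Or32; exists g => //=; rewrite eqxx.
  + exact: Or31.
  + apply: Or32; exists g' => //=; case: eqP => // zz.
    by rewrite zz nz in z'g'.
  + have [zz|zz] := eqVneq z' z; last by apply: Or33; rewrite /= mem_filter zz pend.
    apply: Or32; exists g => /=; first by rewrite zz eqxx.
    rewrite rE zz {1}zE coord_tilt// => jk.
    by move: kz; rewrite -jk -zz pend.
- move=> z' g'; case: eqP => [-> [<-]|_ z'g'] w lw; last exact: a3 z'g' _ (ls _ lw).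
  have lw' := ls _ lw; have [_ wR] := live_bounded vs lw'.
  rewrite [X in _ < dot _ X]zE; apply: eP; first exact: wR.
  case: lw => [|[v' [wv' wk']]]; [by left|right; exists v'; split=> // v'v].
  have [i] := wk' k; rewrite /= /upd v'v !eqxx /= => iS; exact: S'P.
- move=> z' j'; rewrite mem_filter => /andP[/= z'z /a4[z'n z'v]]; split=> //.
  by move: z'z; rewrite /at_point /= => /negPf->.
- by move=> v' k'; rewrite /upd; case: ifP.
- by move=> v' k'; rewrite /upd; case: ifP.
- move=> v' k' tk'; rewrite /upd; case: ifP => [/andP[_ /eqP kk]|_]; last exact: a7.
  by move: tk'; rewrite kk ltnNge -ltnS kt.
- move=> v' /cheap_cons /a8; have := count_v v'; have := sum_cuts v'; rewrite /= => ->.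
  have -> : over_corner v' (z, j) = (v' == v).
    by rewrite /over_corner /= zv (inj_eq (@vert_inj R n)) eq_sym.
  rewrite /visits; case: eqP => _ /=; nia.
- move=> v' /cheap_cons /a9 lt z' /lt; apply: leq_trans.
  by rewrite count_filter; apply: sub_count => x /= /andP[].
Qed.

Lemma card_asked z (p : seq (pt * 'I_(n + d))) :
  (#|[set k : 'I_d | (z, rshift n k) \in p]%SET| <= count (at_point z) p)%N.
Proof.
rewrite -size_filter -(size_map snd).
apply: leq_trans (card_size _).
rewrite -(card_imset _ (@rshift_inj n d)); apply: subset_leq_card.
apply/fintype.subsetP => _ /imsetP[k + ->]; rewrite inE => kp.
by apply/mapP; exists (z, rshift n k) => //; rewrite mem_filter kp /at_point /= eqxx.
Qed.

Lemma card_initial_segment m : (m <= d)%N -> #|[set k : 'I_d | (k < m)%N]%SET| = m.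
Proof.
move=> md; have widen_ord_inj : injective (widen_ord md).
  by move=> i j /(congr1 val) ij; apply: val_inj.
rewrite -[RHS]card_ord -(card_imset _ widen_ord_inj).
apply: eq_card => k; rewrite inE; apply/idP/imsetP => [km|[i _ ->]]; last exact: (ltn_ord i).
by exists (Ordinal km) => //; apply: val_inj.
Qed.

(** If no cutting direction is available at a point queried [t] times, then at
    least [t.+1] unasked directions have undergone all [H] cuts, which cost
    [t.+1 ^ 2 * H] queries: the corner is no longer cheap. *)
Lemma respond h s z j : valid h s -> exists r s', valid ((z, j, r) :: h) s'.
Proof.
move=> vs.
case nz: (normal s z) => [g|].
  by exists (coord g j), s; apply: valid_keep => //; apply: Or32; exists g.
have [zz|zz] := boolP (z \in zeros s).
  by exists 0, s; apply: valid_keep => //; apply: Or31.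
have [[v zv]|nzv] := pselect (exists v, z.1 = vert v); last first.
  by apply: (respond_off_corners _ vs zz nz) => v zv; apply: nzv; exists v.
have [ct|tc] := ltnP (count (at_point z) (pending s)) t.
  exists (coord (outward z) j),
    (State (zeros s) (normal s) ((z, j) :: pending s) (alive s) (cuts s)).
  exact: valid_pend zv _.
have [[k [kt kz ck]]|nk] := pselect (exists k : 'I_d,
    [/\ (k < t.*2.+1)%N, (z, rshift n k) \notin pending s & (cuts s v k < H)%N]).
  exact: valid_cut zv tc kt kz ck.
exists (coord (outward z) j),
  (State (zeros s) (normal s) ((z, j) :: pending s) (alive s) (cuts s)).
apply: (valid_pend vs nz zv) => ch; exfalso.
have chs := cheap_cons ch.
have light := valid_light vs chs zv; have budget := valid_budget vs chs.
pose A := [set k : 'I_d | (k < t.*2.+1)%N]%SET.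
pose B := [set k : 'I_d | (z, rshift n k) \in pending s]%SET.
have Ht k : k \in A :\: B -> cuts s v k = H.
  rewrite !inE => /andP[kB kA]; apply/eqP; rewrite eqn_leq (valid_cuts vs) leqNgt.
  by apply/negP => kH; apply: nk; exists k.
have ABt : (t.+1 <= #|A :\: B|)%N.
  have At : #|A| = t.*2.+1 by apply: card_initial_segment; lia.
  have := card_asked z (pending s); rewrite -/B.
  have := subset_leq_card (subsetIr A B); have := cardsID B A; rewrite At; lia.
have : (t.+1 * H <= \sum_k cuts s v k)%N.
  rewrite (bigID (mem (A :\: B))) /= (eq_bigr (fun=> H)) => [|k]; last exact: Ht.
  by rewrite sum_nat_const (leq_trans _ (leq_addr _ _))// leq_mul2r ABt orbT.
move: chs budget; rewrite /cheap; nia.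
Qed.
End Adversary.

(** * Hiding a cube from a short transcript *)

Lemma sqr_le_expn2 t H : (0 < t)%N -> (t.+1 ^ 2 * H <= 4 * 2 ^ (H * t))%N.
Proof.
case: H => [|H] t0; first by rewrite muln0.
have tP : (t.+1 ^ 2 <= 4 * 2 ^ t)%N.
  case: t t0 => [//|[//|t]] _; elim: t => [//|t IH].
  rewrite (expnS 2 t.+2); move: IH; rewrite -!mulnn; move: (2 ^ t.+2)%N => x; nia.
have HP : (H.+1 <= 2 ^ (H * t))%N.
  by apply: leq_trans (ltn_expl H (isT : 1 < 2)%N) _; rewrite leq_exp2l// leq_pmulr.
by rewrite (mulSn H t) expnD mulnA; exact: leq_mul.
Qed.

Section Hiding.
Context {R : realType} {n d : nat}.
Local Notation pt := ('rV[R]_n * 'rV[R]_d)%type.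
Local Notation corner := {ffun 'I_n -> bool}.
Variables (Rad rho : R) (K t H : nat) (c : 'I_K -> R).
Hypothesis rho_gt0 : 0 < rho.
Hypothesis Rad_ge0 : 0 <= Rad.
Hypothesis Rad_ge1 : n = 0%N \/ 1 <= Rad.
Hypothesis c_bound : forall i, `|c i| + rho <= Rad.
Hypothesis c_sep : forall i j : 'I_K, (i < j)%N -> c i + rho < c j - rho.
Hypothesis HK : (2 ^ H <= K)%N.
Hypothesis t_lt : (4 * t < d)%N.
Implicit Types (v : corner) (z w : pt) (h : seq (pt * 'I_(n + d) * R)).
Local Notation state := (@state R n d K).
Local Notation valid := (@valid R n d Rad rho K t H c).

(** The adversary is followed for at most [N] queries.  Either the algorithm has
    reported by then, or it asks more than [N] queries on every map consistent with
    the transcript. *)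
Lemma play N (alg : algorithm (@Qcoord R n d)) h (s : state) : valid h s ->
  exists h' (s' : state), [/\ valid h' s', {subset h <= h'},
    (size h' <= size h + N)%N &
    let consistent (g : pt -> pt) := forall z j r, (z, j, r) \in h' -> coord (g z) j = r in
    let outcome (g : pt -> pt) := run (fun z (q : @Qcoord R n d) => val q (g z)) alg in
    (exists res, forall g, consistent g -> (outcome g).1 = res) \/
    (forall g, consistent g -> (N < (outcome g).2)%N)].
Proof.
elim: alg N h s => [res|z q next IH] [|N] h s vs.
- by exists h, s; rewrite addn0; split=> //; left; exists res.
- by exists h, s; rewrite leq_addr; split=> //; left; exists res.
- by exists h, s; rewrite addn0; split=> //; right=> g _ /=; case: (run _ _).
have [j qE] : Qcoord (val q) by exact: (set_mem (valP q)).
have [r [s1 vs1]] := respond Rad_ge0 c_bound c_sep t_lt z j vs.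
have [h' [s' [vs' sub size_h' outP]]] := IH r N _ _ vs1.
exists h', s'; split=> //.
- by move=> x xh; apply: sub; rewrite inE xh orbT.
- by rewrite addnS -addSn.
have ans (g : pt -> pt) : (forall z j r, (z, j, r) \in h' -> coord (g z) j = r) -> val q (g z) = r.
  by rewrite qE; apply; apply: sub; rewrite mem_head.
case: outP => [[res resP]|outN]; [left; exists res|right] => g gP /=; rewrite (ans _ gP).
  by have := resP g gP; case: (run _ _).
by have := outN g gP; case: (run _ _).
Qed.

Definition hidden v (a : 'I_d -> 'I_K) : set pt :=
  [set w : pt | w.1 = vert v /\ forall k, `|w.2 ord0 k - c (a k)| <= rho].

(** Cutting directions take any alive cell, hiding directions the choice of
    [avoid_all]; a point has at most [t] open queries, which leaves it [t] unasked
    hiding directions. *)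
Lemma hide_from_pending h (s : state) v : valid h s -> cheap t H v h ->
  exists a : 'I_d -> 'I_K, (forall k, a k \in alive s v k) /\
    forall z j, (z, j) \in pending s -> z.1 = vert v ->
      exists2 k, (z, rshift n k) \notin pending s & rho < `|z.2 ord0 k - c (a k)|.
Proof.
move=> vs ch.
have K0 : (0 < K)%N by apply: leq_trans HK; rewrite expn_gt0.
pose zs := [seq e.1 | e <- pending s & over_corner v e].
pose F z := [set k : 'I_d | (t.*2 < k)%N && ((z, rshift n k) \notin pending s)]%SET.
pose P z (k : 'I_d) := [pred i | i \in
  [set i : 'I_K | (z.2 ord0 k - c i <= rho)%R && (c i - z.2 ord0 k <= rho)%R]%SET].
have zsP z : z \in zs -> z.1 = vert v.
  by move=> /mapP[e + ->]; rewrite mem_filter => /andP[/eqP].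
have size_zs : (size zs <= visits v h)%N.
  rewrite size_map size_filter; exact: leq_trans (leq_addl _ _) (valid_budget vs ch).
have Ft z : z \in zs -> (t <= #|F z|)%N.
  move=> /zsP zv; have light := valid_light vs ch zv.
  pose A := [set k : 'I_d | (k < t.*2.+1)%N]%SET.
  pose B := [set k : 'I_d | (z, rshift n k) \in pending s]%SET.
  have At : #|A| = t.*2.+1 by apply: card_initial_segment; lia.
  have Bt : (#|B| <= t)%N := leq_trans (card_asked _ _) light.
  have -> : F z = ~: (A :|: B).
    by apply/setP => k; rewrite !inE negb_or -leqNgt.
  have := cardsCs (A :|: B); rewrite card_ord; have := (leq_card_setU A B).1; rewrite At.
  by have := max_card (A :|: B); rewrite card_ord; lia.
have P1 z k : (#|P z k| <= 1)%N.
  exact: (card_cells_around c_sep).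
have zst : (size zs < K ^ t)%N.
  (* for t = 0 every query is committed at once and no point is open *)
  have [t0|t0] := posnP t; last first.
    have := sqr_le_expn2 H t0; rewrite expnM.
    have : ((2 ^ H) ^ t <= K ^ t)%N by rewrite leq_exp2r.
    by move: ch; rewrite /cheap; lia.
  rewrite [X in (_ < _ ^ X)%N]t0 expn0 ltnS leqn0 size_eq0.
  case zsE : zs => [//|z zs'].
  have /mapP[e] : z \in zs by rewrite zsE mem_head.
  rewrite mem_filter => /andP[/eqP ev es] _.
  have := valid_light vs ch ev; rewrite t0 leqNgt -has_count => /negP[].
  by apply/hasP; exists e => //; rewrite /at_point.
have [b bP] := avoid_all K0 Ft P1 zst.
have alive_ex k : exists i, i \in alive s v k.
  by apply/set0Pn; rewrite -card_gt0 (leq_trans _ (valid_alive vs v k))// expn_gt0.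
have [p pP] := boolp.choice alive_ex.
exists (fun k : 'I_d => if (t.*2 < k)%N then b k else p k); split=> [k|z j zj zv].
  by case: ifP => [tk|_]; [rewrite (valid_uncut vs) ?finset.in_setT|exact: pP].
have [|k] := bP z.
  by apply/mapP; exists (z, j); rewrite ?mem_filter ?zj ?andbT// /over_corner zv.
rewrite inE => /andP[tk kz] far; exists k; rewrite ?tk//.
rewrite ltNge ler_norml; apply: contra far => /andP[f1 f2].
by rewrite !inE; apply/andP; split; lra.
Qed.

(** The normals still open are now chosen: over [v] by a tilt in a direction where
    the point is outside the hidden cell, over the other corners by [outward]
    alone. *)
Lemma hide h (s : state) v : valid h s -> cheap t H v h ->
  exists a (g : pt -> pt), forall z,
    (forall j r, (z, j, r) \in h -> coord (g z) j = r) /\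
    (forall j r, (z, j, r) \in h -> z \in zeros s /\ g z = 0 \/
      forall w, w \in zeros s \/ hidden v a w -> dot (g z) w < dot (g z) z).
Proof.
move=> vs ch; have [a [alive_a pend_a]] := hide_from_pending vs ch.
have hid_live w : w \in zeros s \/ hidden v a w -> live rho c s w.
  case=> [|[wv wk]]; first by left.
  by right; exists v; split=> // k; exists (a k).
suff /boolp.choice[g gP] z : exists g : pt,
    (forall j r, (z, j, r) \in h -> coord g j = r) /\
    (forall j r, (z, j, r) \in h -> z \in zeros s /\ g = 0 \/
      forall w, w \in zeros s \/ hidden v a w -> dot g w < dot g z).
  by exists a, g.
have [zz|nzz] := boolP (z \in zeros s).
  exists 0; split=> [j r /(valid_answered vs)|]; last by left.
  case=> [[_ ->]|[g zg _]|[zj _]].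
  - by rewrite /Defs.coord row_mx0 mxE.
  - by have := valid_normal vs zg (hid_live _ (or_introl zz)); rewrite ltxx.
  have [_ [v' zv']] := valid_pending vs zj.
  by have [_ /(_ v')] := valid_zeros vs zz.
case zn: (normal s z) => [g|].
  exists g; split=> [j r /(valid_answered vs)|_ _ _]; last first.
    by right=> w /hid_live; exact: valid_normal vs _ _ zn _.
  case=> [[zz]|[g']|[zj _]]; first by rewrite zz in nzz.
    by rewrite zn => -[->] ->.
  by have [] := valid_pending vs zj; rewrite zn.
have pendP j r : (z, j, r) \in h -> (z, j) \in pending s /\ r = coord (outward z) j.
  by move/(valid_answered vs) => [[zz]|[g]|//]; [rewrite zz in nzz|rewrite zn].
have [[j0 zj0]|npend] := pselect (exists j, (z, j) \in pending s); last first.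
  by exists 0; split=> j r /pendP[zj _]; case: npend; exists j.
have [_ [v' zv']] := valid_pending vs zj0.
have zeros_far w : w \in zeros s -> in_cube w.1 /\ w.1 <> vert v' by move=> /(valid_zeros vs)[].
have [vv|/eqP vv] := eqVneq v' v; last first.
  exists (outward z); split=> [j r /pendP[_ ->]//|_ _ _]; right=> w.
  have -> : z = (vert v', z.2) by rewrite -zv'; case: (z).
  case=> [/zeros_far[w01 wv']|[wv _]]; first exact: outward_separates.
  have := outward_separates_vert z.2 wv (fun E => vv (esym E)); lra.
have [k kz far] : exists2 k, (z, rshift n k) \notin pending s & rho < `|z.2 ord0 k - c (a k)|.
  by apply: pend_a zj0 _; rewrite zv' vv.
have [sgn [sgn1 sgnP]] : exists sgn : R, `|sgn| = 1 /\
    forall x, `|x - c (a k)| <= rho -> sgn * x < sgn * z.2 ord0 k.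
  move: far; rewrite ltr_normr => /orP[] far.
    exists 1; rewrite normr1; split=> // x; rewrite ler_norml !mul1r => /andP[_]; lra.
  exists (-1); rewrite normrN1; split=> // x; rewrite ler_norml !mulN1r => /andP[+ _]; lra.
have [e eP] := tilt_separates z.2 k sgn1 Rad_ge0 zeros_far.
have zE : z = (vert v', z.2) by rewrite -zv'; case: (z).
exists (tilt z k e); split=> [j r /pendP[zj ->]|_ _ _].
  by apply: coord_tilt => jk; rewrite -jk zj in kz.
right=> w ww; rewrite [in X in X < _]zE [in X in _ < X]zE; apply: eP.
  by have [_] := live_bounded c_bound vs (hid_live _ ww).
case: ww => [|[wv wk]]; first by left.
by right; exists v; split=> // _; exact: sgnP.
Qed.

(** Pigeonhole: a query point lies over at most one corner. *)
Lemma cheap_corner h : (4 * size h < 2 ^ n * (t.+1 ^ 2 * H))%N -> exists v, cheap t H v h.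
Proof.
move=> hn; apply: contrapT => nch.
have le v : (t.+1 ^ 2 * H <= 4 * visits v h)%N.
  by rewrite leqNgt; apply/negP => ?; apply: nch; exists v.
have : (\sum_(v : corner) (t.+1 ^ 2 * H) <= \sum_(v : corner) 4 * visits v h)%N.
  by apply: leq_sum => v _; exact: le.
rewrite sum_nat_const card_ffun card_bool card_ord -big_distrr /=.
apply/negP; rewrite -ltnNge; apply: leq_trans hn; rewrite ltnS leq_mul2l /=.
elim: h {nch le} => [|e h IH]; first by rewrite big1.
rewrite /= (eq_bigr (fun v => over_corner v e.1 + visits v h)%N)// big_split -[(size h).+1]add1n /=.
apply: leq_add => //.
have [[v ev]|nv] := pselect (exists v, over_corner v e.1).
  rewrite (bigD1 v)//= ev big1// => v' v'v; apply/eqP; rewrite eqb0.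
  apply: contra v'v => /eqP ev'; apply/eqP/(@vert_inj R n).
  by rewrite -ev'; exact/eqP.
rewrite big1// => v _; apply/eqP; rewrite eqb0; apply/negP => ev.
by apply: nv; exists v.
Qed.

(** Strict inequalities on the generators pass to the closed hull only with a
    margin, given here by finiteness and for the cube by its maximising corner. *)
Lemma finite_gap (W : seq pt) g (x : R) : (forall w, w \in W -> dot g w < x) ->
  exists2 b, b < x & forall w, w \in W -> dot g w <= b.
Proof.
elim: W => [|w W IH] Wx; first by exists (x - 1) => //; lra.
have [|b bx bW] := IH; first by move=> w' w'W; apply: Wx; rewrite inE w'W orbT.
exists (Num.max b (dot g w)); first by rewrite gt_max bx Wx// mem_head.
move=> w'; rewrite inE => /predU1P[->|/bW]; rewrite le_max ?lexx ?orbT//.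
by move->.
Qed.

Lemma hidden_max v a g : exists2 w0, hidden v a w0 &
  forall w, hidden v a w -> dot g w <= dot g w0.
Proof.
exists (vert v, \row_k (c (a k) + rho * Num.sg (g.2 ord0 k))).
  split=> // k; rewrite mxE addrAC subrr add0r normrM gtr0_norm//.
  by rewrite normr_sg; case: eqP => _ /=; [rewrite mulr0 ltW|rewrite mulr1].
move=> w [wv wk]; rewrite !dotE wv lerD2l; apply: ler_sum => k _; rewrite mxE.
rewrite -subr_ge0 -mulrBr; set x := w.2 ord0 k.
have : `|x - c (a k)| <= rho := wk k.
rewrite ler_norml => /andP[x1 x2]; case: sgrP.
- by move=> ->; rewrite mul0r.
- by rewrite mulr1 => /ltW g0; apply: mulr_ge0 => //; lra.
- by rewrite mulrN1 => /ltW g0; apply: mulr_le0 => //; lra.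
Qed.

Lemma closed_hull_separated (W : seq pt) v a g z :
  (forall w, w \in W \/ hidden v a w -> dot g w < dot g z) ->
  forall w, closed_hull [set w | w \in W \/ hidden v a w] w -> dot g w < dot g z.
Proof.
move=> sep w wC.
have [b bz bW] := finite_gap (fun w wW => sep w (or_introl wW)).
have [w0 hw0 w0max] := hidden_max v a g.
apply: (@le_lt_trans _ _ (Num.max b (dot g w0))); last first.
  by rewrite gt_max bz sep//; right.
apply: wC => w' /= [/bW|/w0max] le; rewrite le_max le ?orbT//.
Qed.

Lemma fractional_box w : fractional Rad w -> box Rad w.
Proof.
move=> [w01 _ wR] j; case: (split_ordP j) => i ->; last by rewrite coord_rshift.
rewrite coord_lshift; have /andP[w0 w1] := w01 i; rewrite ger0_norm//.
apply: le_trans w1 _; case: Rad_ge1 => // n0.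
by have := ltn_ord i; rewrite [X in (_ < X)%N]n0.
Qed.

Lemma hidden_box v a w : hidden v a w -> box Rad w.
Proof.
move=> [wv wk] j; case: (split_ordP j) => i ->.
  rewrite coord_lshift wv; have /andP[w0 w1] := @in_cube_vert R n v i; rewrite ger0_norm//.
  apply: le_trans w1 _; case: Rad_ge1 => // n0.
  by have := ltn_ord i; rewrite [X in (_ < X)%N]n0.
rewrite coord_rshift; apply: le_trans (c_bound (a i)).
rewrite addrC -[X in `|X|](subrK (c (a i))) (le_trans (ler_normD _ _))// lerD2r.
exact: wk.
Qed.

(** An integral point of the hull would be over a corner [v], but [outward]
    separates it from finitely many points not over [v]. *)
Lemma hull_fractional_infeasible (W : seq pt) :
  (forall w, w \in W -> fractional Rad w) ->
  closed_hull [set w | w \in W] `&` mixed_integer = set0.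
Proof.
move=> WF; rewrite -subset0 => p [pW /mxOverP pint].
have p01 : in_cube p.1.
  move=> i; rewrite -coord_lshift -dot_unit_at; apply/andP; split; last first.
    apply: pW => w /WF[/(_ i)]; rewrite dot_unit_at coord_lshift.
    by case/andP.
  rewrite -oppr_le0 -mulN1r -dotZl; apply: pW => w /WF[/(_ i)].
  by rewrite dotZl mulN1r dot_unit_at coord_lshift oppr_le0 => /andP[].
have [v pv] : exists v, p.1 = vert v.
  exists [ffun i => p.1 ord0 i == 1]; apply/rowP => i; rewrite mxE ffunE.
  have := p01 i; have /intrP[m ->] := pint ord0 i.
  rewrite ler0z -[1 in X in _ && X]/(1%:~R) ler_int => m01.
  have [->|->] : m = 0 \/ m = 1 by lia.
    by rewrite mulr0z eq_sym oner_eq0.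
  by rewrite mulr1z eqxx.
have [w wW|b bp bW] := @finite_gap W (outward p) (dot (outward p) p).
  have [w01 wv _] := WF w wW.
  have -> : p = (vert v, p.2) by rewrite -pv; case: (p).
  exact: outward_separates.
by have := pW _ _ bW; rewrite leNgt bp.
Qed.

(** The two instances are [C0], the hull of the points answered 0, and [C1], which
    also contains the hidden cube; both get the answers of the transcript. *)
Lemma coordinate_oracle_bound k (alg : algorithm (@Qcoord R n d)) :
  solves_within Rad rho k alg -> (2 ^ n * (t.+1 ^ 2 * H) <= 4 * k)%N.
Proof.
move=> sol; rewrite leqNgt; apply/negP => few.
have d0 : (0 < d)%N by lia.
have [h [s [vs _ size_h outP]]] := play k alg (valid_init Rad rho t c HK).
have [v ch] : exists v, cheap t H v h.
  by apply: cheap_corner; apply: leq_ltn_trans few; rewrite leq_mul2l.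
have [a [g gP]] := hide vs ch.
pose C0 : set pt := closed_hull [set w | w \in zeros s].
pose C1 : set pt := closed_hull [set w | w \in zeros s \/ hidden v a w].
have C01 : C0 `<=` C1 by apply: closed_hull_mono => w /= ws; left.
have inf0 : C0 `&` mixed_integer = set0 by apply: hull_fractional_infeasible; exact: valid_zeros vs.
have box1 : C1 `<=` box Rad.
  by apply: closed_hull_bounded => w /= [/(valid_zeros vs)/fractional_box|/hidden_box].
have I0 : instances Rad rho C0.
  split; [exact: closed_closed_hull|exact: convex_closed_hull| |].
    by move=> z /C01/box1.
  by rewrite inf0 => /set0P; rewrite eqxx.
have vint y : mixed_integer (vert v, y : 'rV[R]_d).
  by apply/mxOverP => i j; rewrite mxE; case: (v j); rewrite /= ?rpred0 ?rpred1.
pose center : 'rV[R]_d := \row_k c (a k).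
have ball1 y : `|y - center| <= rho -> C1 (vert v, y).
  move=> yc; apply: sub_closed_hull; right; split=> // l.
  by have := norm_ball_coord l yc; rewrite mxE.
have I1 : instances Rad rho C1.
  split; [exact: closed_closed_hull|exact: convex_closed_hull|exact: box1|].
  move=> _; exists (vert v), center; split; first exact: vint.
  by move=> _ [y yc <-]; exact: ball1.
have feas1 : C1 `&` mixed_integer !=set0.
  by exists (vert v, center); split; [apply: ball1; rewrite subrr normr0 ltW|exact: vint].
have [w0 hw0 _] := hidden_max v a 0.
have [G0 G0P] := @first_order_map_exists R n d Rad rho d0.
pose queried z := exists j r, (z, j, r) \in h.
pose G (C : set pt) (z : pt) : pt :=
  if `[< (C = C0 \/ C = C1) /\ queried z >] then g z else G0 C z.
have GP : first_order_map Rad rho G.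
  move=> C CI z; rewrite /G; case: asboolP => [[C01E [j [r zh]]]|_]; last exact: G0P.
  have [_ /(_ _ _ zh)[[zs gz]|sep]] := gP z.
    have Cz : C z by case: C01E => ->; apply: sub_closed_hull => //; left.
    by split=> // /(_ Cz).
  have sepC w : C w -> dot (g z) w < dot (g z) z.
    by move=> Cw; apply: (closed_hull_separated sep); case: C01E Cw => -> // /C01.
  split=> [/sepC|_]; first by rewrite ltxx.
  split=> // gz0; have := sep w0 (or_intror hw0).
  by rewrite gz0 !dot0l ltxx.
have consistent C : C = C0 \/ C = C1 -> forall z j r, (z, j, r) \in h -> coord (G C z) j = r.
  move=> C01E z j r zh; rewrite /G; case: asboolP => [_|[]]; first by have [/(_ _ _ zh)] := gP z.
  by split=> //; exists j, r.
have cons0 := consistent C0 (or_introl erefl); have cons1 := consistent C1 (or_intror erefl).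
case: outP => [[res resP]|outk].
  apply: (indistinguishable_not_solved GP I1 I0 feas1 inf0 _ sol).
  exact: etrans (resP _ cons1) (esym (resP _ cons0)).
by have [_] := sol _ GP _ I0; rewrite leqNgt (outk _ cons0).
Qed.
End Hiding.

(** * The number of cells and the final estimate *)

Section Scale.
Context {R : realType}.

(** [K] is the largest number of cells that fit disjointly; the strict inequality
    [rho < Rad / 2] is what allows two of them. *)
Lemma cell_count (Rad rho : R) : 0 < rho -> rho < Rad / 2 ->
  exists2 K : nat, (1 < K)%N & K%:R * rho < Rad <= K.+1%:R * rho.
Proof.
move=> rho0 rhoR.
have ex : exists K : nat, Rad <= K.+1%:R * rho.
  exists (Num.bound (Rad / rho)); rewrite -ler_pdivrMr//.
  apply: le_trans (ltW (archi_boundP _)) _; last by rewrite ler_nat.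
  by rewrite divr_ge0//; lra.
case: (ex_minnP ex) => K KP Kmin; exists K; last first.
  rewrite KP andbT ltNge; apply/negP; case: K KP Kmin => [|K] KP Kmin.
    by rewrite mul0r; lra.
  by move/Kmin; rewrite ltnn.
case: K KP {Kmin} => [|[|//]] KP; first by move: KP; rewrite mul1r; lra.
by move: KP; lra.
Qed.

Definition cell_center (Rad : R) (K : nat) (i : 'I_K) : R :=
  Rad / K%:R * (2 * i%:R + 1) - Rad.

Section Centers.
Variables (Rad rho : R) (K : nat).
Hypothesis K_gt0 : (0 < K)%N.
Hypothesis rho_gt0 : 0 < rho.
Hypothesis K_rho : K%:R * rho < Rad.

Let half_width_gt : rho < Rad / K%:R.
Proof. by rewrite ltr_pdivlMr ?ltr0n// mulrC. Qed.

Lemma cell_center_bound i : `|@cell_center Rad K i| + rho <= Rad.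
Proof.
rewrite -lerBrDr ler_norml /cell_center.
have KR : Rad / K%:R * K%:R = Rad by rewrite divfK// pnatr_eq0 -lt0n.
have i0 : 0 <= (i : nat)%:R :> R by [].
have iK : (i : nat)%:R + 1 <= K%:R :> R by rewrite natr1 ler_nat.
move: half_width_gt KR; move: (Rad / K%:R) => x xr xK.
have x0 : 0 <= x by exact: ltW (lt_trans rho_gt0 xr).
have := mulr_ge0 x0 i0; have := ler_wpM2l x0 iK.
by rewrite !mulrDr xK => *; apply/andP; split; lra.
Qed.

Lemma cell_center_sep (i j : 'I_K) : (i < j)%N ->
  @cell_center Rad K i + rho < @cell_center Rad K j - rho.
Proof.
move=> ij; rewrite /cell_center.
have ij1 : (i : nat)%:R + 1 <= (j : nat)%:R :> R by rewrite natr1 ler_nat.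
move: half_width_gt; move: (Rad / K%:R) => x xr.
by have := ler_wpM2l (ltW (lt_trans rho_gt0 xr)) ij1; rewrite !mulrDr; lra.
Qed.
End Centers.

(** The factor 2 absorbs the rounding of the logarithm, as [K.+1 <= 2 ^ (H + 1)] and
    [0 < H]. *)
Lemma ln_le_trunc_log (x : R) (K : nat) : 0 < x -> (1 < K)%N -> x <= K.+1%:R ->
  ln x <= 2 * (trunc_log 2 K)%:R.
Proof.
move=> x0 K1 xK; set H := trunc_log 2 K.
have K0 : (0 < K)%N by apply: ltnW.
have /andP[_ KH] := trunc_log_bounds (isT : (1 < 2)%N) K0.
have H0 : (0 < H)%N by rewrite trunc_log_gt0.
have xH : x <= 2 ^+ (H * 2).
  apply: le_trans xK _; rewrite -natrX ler_nat; apply: leq_trans KH _.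
  by rewrite leq_exp2l//; lia.
apply: (@le_trans _ _ (ln (2 ^+ (H * 2)))).
  by rewrite ler_ln ?posrE ?exprn_gt0.
have ln2 : ln 2 <= 1 :> R.
  by rewrite -[X in ln X]/(1 + 1); apply: le_ln1Dx; rewrite (lt_trans _ ltr01)// ltrN10.
rewrite lnXn// -[leLHS]mulr_natr natrM.
by have := ler_wpM2r (ler0n R H) ln2; lra.
Qed.
End Scale.

Lemma coordinate_oracle_icomp (R : realType) (n d : nat) (Rad rho : R) :
  (1 <= d)%N -> 0 < rho -> rho < Rad / 2 -> n = 0%N \/ 1 <= Rad ->
  ((128^-1 * (2 ^+ n * d%:R ^+ 2 * ln (Rad / rho)))%:E <= icomp Rad rho (@Qcoord R n d))%E.
Proof.
move=> d1 rho0 rhoR Rad1; apply: le_icomp => k alg sol.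
have Rad0 : 0 < Rad by lra.
have [K K1 /andP[Krho RadK]] := cell_count rho0 rhoR.
have K0 : (0 < K)%N by apply: ltnW.
set t := ((d - 1) %/ 4)%N; set H := trunc_log 2 K.
have td : (4 * t < d)%N by rewrite /t; lia.
have dt : (d <= 4 * t.+1)%N by rewrite /t; lia.
have HK : (2 ^ H <= K)%N by case/andP: (trunc_log_bounds (isT : (1 < 2)%N) K0).
have bound := coordinate_oracle_bound rho0 (ltW Rad0) Rad1
  (cell_center_bound K0 rho0 Krho) (cell_center_sep K0 rho0 Krho) HK td sol.
have lnH : ln (Rad / rho) <= 2 * H%:R.
  by apply: ln_le_trunc_log => //; [rewrite divr_gt0|rewrite ler_pdivrMr].
have d2 : (2 ^ n * (d ^ 2 * H) <= 64 * k)%N.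
  apply: (@leq_trans (2 ^ n * ((4 * t.+1) ^ 2 * H))%N); last by move: bound; rewrite expnMn; lia.
  by rewrite leq_mul2l leq_mul2r leq_exp2r// dt !orbT.
(* 128 = 2 * 4 * 16: the rounding of the logarithm, the 4 in [cheap], and d <= 4 * t.+1 squared *)
rewrite mulrC ler_pdivrMr//.
apply: (@le_trans _ _ (2 ^+ n * d%:R ^+ 2 * (2 * H%:R))).
  by rewrite ler_wpM2l// mulr_ge0// exprn_ge0.
move: d2; rewrite -(@ler_nat R) !natrM !natrX; lra.
Qed.

Theorem theorem3 (R : realType) :
  (exists2 c : R, 0 < c &
    forall (n d : nat) (Rad rho : R),
      (1 <= d)%N -> 0 < Rad -> 0 < rho -> rho < Rad / 2 ->
      ((c * (2 ^+ n * d%:R ^+ 2 * ln (Rad / rho)))%:E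
         <= icomp Rad rho (@Qbit R n d))%E) /\
  (exists2 c : R, 0 < c &
    forall (n d : nat) (Rad rho : R),
      (1 <= d)%N -> 0 < Rad -> 0 < rho -> rho < Rad / 2 ->
      (n = 0%N \/ 1 <= Rad) ->
      ((c * (2 ^+ n * d%:R ^+ 2 * ln (Rad / rho)))%:E
         <= icomp Rad rho (@Qcoord R n d))%E).
Proof.
split.
  exists 1 => // n d Rad rho d1 Rad0 rho0 rhoR; apply: le_icomp => k alg sol.
  have rhoRad : rho <= Rad by lra.
  by case: (bit_oracle_unsolvable d1 rho0 rhoRad sol).
exists 128^-1 => // n d Rad rho d1 _ rho0 rhoR Rad1.
exact: coordinate_oracle_icomp.
Qed.
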